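(* Let $N>1$, let $E$ be a Polish linear space of dimension at least $2N-1$, and let $C\subseteq[2^\omega]^N$ be an $F_\sigma$ coloring of the Cantor set. Then there exist a $G_\delta$ set $S\subseteq E$, a set $X\subseteq S$ and a homeomorphism $f\colon2^\omega\to X$ such that $S\setminus X$ is a countable union of convex sets and for every $T\in[X]^N$ we have $\mathrm{conv}\,T\not\subseteq S$ if and only if $f^{-1}[T]\in C$.
   Context: A Polish linear space is a real topological vector space whose topology is Polish. $\mathrm{conv}\,T$ denotes the convex hull of $T$. $[Y]^N$ denotes the family of $N$-element subsets of $Y$, topologized as the quotient of the space of one-to-one $N$-tuples in $Y^N$ by the relation identifying tuples with the same range; an $F_\sigma$ coloring is an $F_\sigma$ subset of $[2^\omega]^N$. *)

(* Defs.v *)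
From HB Require Import structures.
From mathcomp Require Import all_boot all_order all_algebra.
From mathcomp Require Import generic_quotient.
From mathcomp Require Import all_classical all_reals all_analysis.
From mathcomp Require Import borel_hierarchy.

Set Implicit Arguments.
Unset Strict Implicit.
Unset Printing Implicit Defensive.

Import Order.TTheory GRing.Theory Num.Theory.
Import numFieldNormedType.Exports.

Local Open Scope classical_set_scope.
Local Open Scope ring_scope.

Section polish.
Context {R : realType} {T : topologicalType}.

Definition is_metric (d : T -> T -> R) :=
  [/\ forall x y, d x y = 0 <-> x = y,
      forall x y, d x y = d y x &
      forall x y z, d x z <= d x y + d y z].

Definition induces_topology (d : T -> T -> R) :=
  forall (x : T) (A : set T),
    nbhs x A <-> exists2 e : R, 0 < e & [set y | d x y < e] `<=` A.

Definition cauchy_seq_for (d : T -> T -> R) (u : nat -> T) :=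
  forall e : R, 0 < e ->
    exists n0 : nat, forall m n : nat,
      (n0 <= m)%N -> (n0 <= n)%N -> d (u m) (u n) < e.

Definition complete_metric (d : T -> T -> R) :=
  forall u : nat -> T, cauchy_seq_for d u -> exists l : T, u @ \oo --> l.

End polish.

Definition polish_space (R : realType) (T : topologicalType) :=
  (exists2 D : set T, countable D & dense D) /\
  (exists d : T -> T -> R,
     [/\ is_metric d, induces_topology d & complete_metric d]).

Definition linearly_independent (R : realType) (E : lmodType R) (n : nat)
    (v : 'I_n -> E) :=
  forall a : 'I_n -> R, \sum_(i < n) a i *: v i = 0 -> forall i, a i = 0.

Definition dim_at_least (R : realType) (E : lmodType R) (n : nat) :=
  exists v : 'I_n -> E, linearly_independent v.

Definition convex_hull (R : realType) (E : lmodType R) (T : set E) : set E :=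
  smallest (@convex_set R E) T.

Definition homeomorphism (S T : topologicalType) (f : S -> T) :=
  continuous f /\
  exists2 g : T -> S, continuous g & cancel f g /\ cancel g f.

Definition Nsubsets (Y : Type) (N : nat) : set (set Y) :=
  [set A | (A #= `I_N)%card].

Section Nsubset_space.
Context (Y : topologicalType) (N : nat).

Definition inj_tuples : set (prod_topology (fun _ : 'I_N => Y)) :=
  [set x | injective x].

Lemma range_inj_tuple (x : inj_tuples) : range (val x) \in @Nsubsets Y N.
Proof.
have /set_mem xinj := valP x.
rewrite inE /Nsubsets /=.
rewrite (card_eqr card_II).
by apply: inj_card_eq => i j _ _; exact: xinj.
Qed.

Definition Nsubset : Type := @Nsubsets Y N.

HB.instance Definition _ := Choice.on Nsubset.

Definition Nsubset_of_tuple (x : inj_tuples) : Nsubset :=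
  exist _ (range (val x)) (range_inj_tuple x).

Lemma Nsubset_of_tuple_surj (A : Nsubset) :
  exists x : inj_tuples, Nsubset_of_tuple x = A.
Proof.
case: A => A Acard; have /card_esym := set_mem Acard.
rewrite (card_eql card_II) => /card_bijP[f [g fK gK]].
pose t i := \val (f (exist _ i (mem_setT i))).
have tinj : t \in inj_tuples.
  by rewrite inE => i j /val_inj /(can_inj fK) [].
exists (exist _ t tinj); apply: val_inj => /=.
apply/seteqP; split => [_ [i _ <-]|y Ay]; first exact: set_valP.
exists (\val (g (exist _ y (mem_set Ay)))) => //=.
set a := exist _ y _; have -> : y = \val a by [].
by rewrite -[in RHS](gK a); congr (\val (f _)); apply: val_inj.
Qed.

Definition tuple_of_Nsubset (A : Nsubset) : inj_tuples :=
  sval (cid (Nsubset_of_tuple_surj A)).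

Lemma tuple_of_NsubsetK : cancel tuple_of_Nsubset Nsubset_of_tuple.
Proof. by move=> A; rewrite /tuple_of_Nsubset; case: cid. Qed.

(* Nsubset is the quotient of the one-to-one tuples by the relation of having
   the same range, the canonical surjection being the range map. *)
HB.instance Definition _ :=
  @isQuotient.Build inj_tuples Nsubset tuple_of_Nsubset Nsubset_of_tuple
    tuple_of_NsubsetK.

Definition Nsubset_space := quotient_topology Nsubset.

(* \val on Nsubset_space would be the choice of a representing tuple. *)
Definition set_of_Nsubset (A : Nsubset_space) : set Y :=
  set_val (A : @Nsubsets Y N).

Lemma open_Nsubset_spaceE (U : set Nsubset_space) :
  open U = open [set x : inj_tuples | U (Nsubset_of_tuple x)].
Proof. by rewrite [in LHS]/open/= /quotient_open unlock. Qed.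

End Nsubset_space.

Arguments set_of_Nsubset {Y N} A.

(* Main.v *)
Require Import Defs.
From HB Require Import structures.
From mathcomp Require Import all_boot all_order all_algebra.
From mathcomp Require Import all_classical all_reals all_analysis.
From mathcomp Require Import borel_hierarchy.
From mathcomp Require Import zify lra.

(** Put the Cantor set on the moment curve of R^(2N-1), where any 2N points are
    affinely independent, so that the open simplices spanned by distinct N-sets
    of the curve are disjoint.  Write the set of one-to-one tuples whose range is
    in C as a union of compact sets D_p, and remove from the unit ball the point
    of the open simplex of x with weight (p+1)/(N+p) at the first vertex and
    1/(N+p) at the others, for each x in D_p.  For each p the removed points form
    a compact set, and these sets converge to the curve as p grows; hence the
    removed points together with the curve form a closed set, and what is left of
    the ball is relatively open, a countable union of convex sets.  A linear
    injection transports everything to E; its restriction to the compact ball is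
    all that is used, so E need not be locally convex. *)

Set Implicit Arguments.
Unset Strict Implicit.
Unset Printing Implicit Defensive.

Import Order.TTheory GRing.Theory Num.Theory.
Import numFieldNormedType.Exports.

Local Open Scope classical_set_scope.
Local Open Scope ring_scope.

(** * Metrizable spaces and G-delta sets *)

Section metrizable.
Context {R : realType} {T : topologicalType} (d : T -> T -> R).
Hypotheses (dm : is_metric d) (dt : induces_topology d).

Lemma is_metric_xx x : d x x = 0.
Proof. by case: dm => d0 _ _; apply/d0. Qed.

Lemma is_metric_ge0 x y : 0 <= d x y.
Proof.
case: dm => _ dC dD; have := dD x y x; rewrite is_metric_xx (dC y x); lra.
Qed.

Lemma metric_hausdorff : hausdorff_space T.
Proof.
case: dm => d0 dC dD p q clpq; apply/d0/eqP; rewrite eq_le is_metric_ge0 andbT.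
rewrite leNgt; apply/negP => dpq.
have d2 : 0 < d p q / 2 by lra.
have np : nbhs p [set y | d p y < d p q / 2] by apply/dt; exists (d p q / 2).
have nq : nbhs q [set y | d q y < d p q / 2] by apply/dt; exists (d p q / 2).
have [z /= [pz qz]] := clpq _ _ np nq.
by have := dD p z q; rewrite (dC z q); lra.
Qed.

(** A closed set is the intersection of its open neighbourhoods of radius [1/(n+1)]. *)
Lemma metric_closed_Gdelta (A : set T) : closed A -> Gdelta A.
Proof.
case: dm => d0 dC dD clA.
exists (fun n => \bigcup_(x in A) [set y | d x y < n.+1%:R^-1]).
  move=> n; apply: bigcup_open => x Ax; rewrite openE => y /= xy; apply/dt.
  exists (n.+1%:R^-1 - d x y); first by rewrite subr_gt0.
  by move=> z /= yz; rewrite (le_lt_trans (dD x y z))// -ltrBrDl.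
apply/seteqP; split => [x Ax n _|y Ay].
  by exists x => //=; rewrite is_metric_xx invr_gt0.
apply: clA => B /dt[e e0 eB].
have [n ne] : exists n, n.+1%:R^-1 < e.
  exists (Num.trunc e^-1); rewrite invf_plt ?posrE//.
  by rewrite truncnS_gt.
have [x Ax /= xy] := Ay n I.
by exists x; split => //; apply: eB => /=; rewrite dC (lt_trans xy).
Qed.

End metrizable.

Lemma Gdelta_setD (T : topologicalType) (A M : set T) :
  Gdelta A -> Fsigma M -> Gdelta (A `\` M).
Proof.
move=> [F oF ->] [G cG ->]; exists (fun i => F i `\` G i).
  by move=> i; apply: openI => //; exact: closed_openC.
apply/seteqP; split => [x [Fx Gx] i _|x FGx].
  by split; [exact: Fx|apply: contra_not Gx => Gix; exists i].
by split=> [i _|[i _]]; have [] := FGx i I.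
Qed.

(** * The ternary embedding of the Cantor set in the unit interval *)

Section ternary.
Context {R : realType}.
Implicit Types x y : cantor_space.

(** The bits, doubled, are digits in base 3: this is the left end of the interval of level [n]
    around the point in the usual construction of the Cantor set. *)
Definition ternary_sum x n : R :=
  \sum_(i < n) (x i)%:R * 2 * 3^-1 ^+ i.+1.

Definition ternary x : R := sup (range (ternary_sum x)).

Lemma ternary_sumS x n :
  ternary_sum x n.+1 = ternary_sum x n + (x n)%:R * 2 * 3^-1 ^+ n.+1.
Proof. by rewrite /ternary_sum big_ord_recr. Qed.

Lemma pow3_gt0 n : 0 < 3^-1 ^+ n :> R.
Proof. by rewrite exprn_gt0// invr_gt0. Qed.

Lemma le_ternary_sum x m n : (m <= n)%N -> ternary_sum x m <= ternary_sum x n.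
Proof.
apply: (homo_leq (@lexx _ _) (@le_trans _ _)) => i /=.
rewrite ternary_sumS lerDl !mulr_ge0// ltW// pow3_gt0.
Qed.

(** Adding [3^-n] gives the right end of the interval of level [n], and these intervals are
    nested. *)
Lemma ge_ternary_sum x m n : (m <= n)%N ->
  ternary_sum x n + 3^-1 ^+ n <= ternary_sum x m + 3^-1 ^+ m.
Proof.
apply: (@homo_leq _ (fun n => ternary_sum x n + 3^-1 ^+ n) (fun a b => b <= a)).
- by move=> a /=.
- by move=> b a c /= ba cb; exact: le_trans cb ba.
move=> i /=; rewrite ternary_sumS exprS.
have := pow3_gt0 i; set e := 3^-1 ^+ i => e0.
by case: (x i) => /=; lra.
Qed.

Lemma ternary_sum_le_add x m n :
  ternary_sum x n <= ternary_sum x m + 3^-1 ^+ m.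
Proof.
have [mn|/ltnW nm] := leqP m n.
  by apply: le_trans (ge_ternary_sum x mn); rewrite lerDl ltW// pow3_gt0.
by rewrite (le_trans (le_ternary_sum x nm))// lerDl ltW// pow3_gt0.
Qed.

Lemma ternary_ge x n : ternary_sum x n <= ternary x.
Proof.
apply: ub_le_sup; last by exists n.
by exists (ternary_sum x 0 + 3^-1 ^+ 0) => _ [k _ <-]; exact: ternary_sum_le_add.
Qed.

Lemma ternary_le x n : ternary x <= ternary_sum x n + 3^-1 ^+ n.
Proof.
apply: ge_sup; first by exists (ternary_sum x 0), 0%N.
by move=> _ [k _ <-]; exact: ternary_sum_le_add.
Qed.

Lemma ternary_itv x : 0 <= ternary x <= 1.
Proof.
have := ternary_ge x 0; have := ternary_le x 0.
by rewrite /ternary_sum big_ord0 add0r expr0 => -> ->.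
Qed.

(** At the first differing digit the two intervals of level [n+1] are separated by a gap of length
    [3^-(n+1)]. *)
Lemma ternary_lt x y n : (forall i, (i < n)%N -> x i = y i) ->
  x n = false -> y n = true -> ternary x < ternary y.
Proof.
move=> xy xn yn.
have e : ternary_sum x n = ternary_sum y n.
  by apply: eq_bigr => i _; rewrite xy.
have := ternary_le x n.+1; have := ternary_ge y n.+1.
by rewrite !ternary_sumS xn yn e /=; have := pow3_gt0 n.+1; lra.
Qed.

Lemma ternary_inj : injective ternary.
Proof.
move=> x y xy; apply/funext => n; elim/ltn_ind: n => n IH.
case xn : (x n); case yn : (y n) => //.
  suff : ternary y < ternary x by rewrite xy ltxx.
  by apply: (@ternary_lt y x n) => // i /IH.
suff : ternary x < ternary y by rewrite xy ltxx.
exact: (@ternary_lt x y n).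
Qed.

(** Fixing the first [n] digits is an open condition and confines the value to an interval of length
    [3^-n]. *)
Lemma ternary_continuous : continuous ternary.
Proof.
move=> x; apply/cvgrPdist_lt => e e0.
have [n ne] : exists n, 3^-1 ^+ n < e :> R.
  have : (3^-1 : R) ^+ n @[n --> \oo] --> 0 by apply: cvg_expr; rewrite ger0_norm; lra.
  move/cvgrPdist_lt => /(_ _ e0) [n _ /(_ n (leqnn n))] /=.
  by rewrite sub0r normrN ger0_norm ?ltW ?pow3_gt0//; exists n.
have : nbhs x [set y : cantor_space | forall i : 'I_n, y i = x i].
  apply: (@filter_forall cantor_space 'I_n (fun i y => y i = x i)
    (nbhs x) (nbhs_filter x)) => i.
  by apply: (@proj_continuous _ (fun _ : nat => bool) i x [set x i]);
     exact: discrete_set1.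
apply: filterS => y xy.
have exy : ternary_sum x n = ternary_sum y n.
  by apply: eq_bigr => i _; rewrite xy.
have := ternary_le x n; have := ternary_ge x n.
have := ternary_le y n; have := ternary_ge y n.
rewrite exy ltr_norml; lra.
Qed.

End ternary.

(** * Colorings as sets of one-to-one tuples *)

Lemma NsubsetsP (Y : topologicalType) N (A : set Y) : Nsubsets N A ->
  exists x : 'I_N -> Y, injective x /\ range x = A.
Proof.
move=> /mem_set NA.
have [x xA] := Nsubset_of_tuple_surj (exist _ A NA : Nsubset Y N).
exists (val x); split; first exact: set_mem (valP x).
by have := congr1 val xA.
Qed.

Lemma coloring_rangeE (Y : topologicalType) N (C : set (Nsubset_space Y N))
    (x : @inj_tuples Y N) :
  (set_of_Nsubset @` C) (range (val x)) <-> C (Nsubset_of_tuple x).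
Proof.
split=> [[B CB Bx]|Cx]; last by exists (Nsubset_of_tuple x : Nsubset_space Y N).
by rewrite (_ : Nsubset_of_tuple x = B)//; apply: val_inj.
Qed.

(** By the quotient topology the one-to-one tuples with range in [C] form a relatively closed set,
    the trace of a closed set [Z] of the product; [Z] may also contain tuples with repetitions. *)
Lemma closed_coloring_tuples (Y : topologicalType) N
    (C : set (Nsubset_space Y N)) : closed C ->
  exists2 Z : set (prod_topology (fun _ : 'I_N => Y)), closed Z &
    forall x, injective x -> Z x <-> (set_of_Nsubset @` C) (range x).
Proof.
move=> /closed_openC; rewrite open_Nsubset_spaceE => -[W oW WC].
exists (~` W); first exact: open_closedC.
move=> x /mem_set xinj.
have := coloring_rangeE C (exist _ x xinj : @inj_tuples Y N) => /= ->.
have /= := congr1 (fun U => U (exist _ x xinj : @inj_tuples Y N)) WC.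
by move=> ->; rewrite not_notE.
Qed.

Lemma tuple_coord_continuous N (Y Z : topologicalType) (g : Y -> Z) (k : 'I_N) :
  continuous g ->
  continuous (fun x : prod_topology (fun _ : 'I_N => Y) => g (x k)).
Proof.
move=> cg x.
exact: (continuous_comp (@proj_continuous _ (fun _ : 'I_N => Y) k x) (cg _)).
Qed.

Lemma compact_tuples N (A : set (prod_topology (fun _ : 'I_N => cantor_space))) :
  closed A -> compact A.
Proof.
move=> cA; apply: (subclosed_compact cA _ (@subsetT _ A)).
have := @tychonoff _ (fun _ : 'I_N => cantor_space) _
  (fun=> cantor_space_compact).
by congr (compact _); rewrite eqEsubset.
Qed.

Lemma separated_tuples_closed (R : realType) N (e : R) :
  closed [set x : prod_topology (fun _ : 'I_N => cantor_space) |
    forall i j, i != j -> e <= `|ternary (x i) - ternary (x j)|].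
Proof.
rewrite (_ : mkset _ = \bigcap_(ij in [set ij : 'I_N * 'I_N | ij.1 != ij.2])
   ((fun x : prod_topology (fun _ : 'I_N => cantor_space) =>
      `|ternary (x ij.1) - ternary (x ij.2)| : R) @^-1` [set t | e <= t])).
  apply: closed_bigI => -[i j] _; apply: preimage_closed; last exact: closed_ge.
  have cx k := @tuple_coord_continuous N _ _ _ k (@ternary_continuous R).
  by move=> x _; apply: cvg_norm; apply: cvgB; exact: cx.
apply/seteqP; split => [x xe [i j] /=|x xe i j ij]; first exact: xe.
exact: (xe (i, j)).
Qed.

Lemma Fsigma_coloring_tuples (R : realType) N
    (C : set (Nsubset_space cantor_space N)) : Fsigma C ->
  exists D : nat -> set (prod_topology (fun _ : 'I_N => cantor_space)),
  [/\ forall p, closed (D p),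
      forall p x, D p x -> injective x /\ (set_of_Nsubset @` C) (range x) &
      forall x, injective x -> (set_of_Nsubset @` C) (range x) ->
        exists p, D p x].
Proof.
move=> [F cF CF].
pose Z n := s2val (cid2 (closed_coloring_tuples (cF n))).
have cZ n : closed (Z n) := s2valP (cid2 (closed_coloring_tuples (cF n))).
have ZE n := s2valP' (cid2 (closed_coloring_tuples (cF n))).
(* The separation makes the sets closed in the whole product, hence compact. *)
pose sep k := [set x : prod_topology (fun _ : 'I_N => cantor_space) |
  forall i j, i != j -> (k.+1%:R^-1 : R) <= `|ternary (x i) - ternary (x j)|].
(* The number [p] codes a closed piece [n] and a separation [k]; a number coding no pair gives the
   empty set. *)
exists (fun p => if unpickle p is Some (n, k) then Z n `&` sep k else set0).
split.
- move=> p; case: (unpickle p) => [[n k]|]; last exact: closed0.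
  by apply: closedI; [exact: cZ|exact: separated_tuples_closed].
- move=> p x; case: (unpickle p) => [[n k]|//] [Znx sx].
  have xinj : injective x.
    move=> i j xij; apply/eqP; apply: contraT => /sx.
    by rewrite xij subrr normr0 leNgt invr_gt0 ltr0Sn.
  split=> //; have [/(_ Znx) + _] := ZE n x xinj.
  by move=> [B FB Bx]; exists B => //; rewrite CF; exists n.
- move=> x xinj [B]; rewrite CF => -[n _ FnB] Bx.
  have [k kx] : exists k, sep k x.
    (* There are finitely many pairs of indices, so one [k] bounds all the inverse distances. *)
    have [k /= kx] : exists k : nat, forall ij : 'I_N * 'I_N,
        ij.1 != ij.2 -> `|ternary (x ij.1) - ternary (x ij.2)|^-1 <= k%:R :> R.
      exists (\max_(ij : 'I_N * 'I_N)
        (Num.trunc (`|ternary (x ij.1) - ternary (x ij.2)|^-1 : R)%R).+1)%N => ij _.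
      apply: le_trans (ltW (truncnS_gt _)) _; rewrite ler_nat.
      exact: (leq_bigmax ij).
    exists k => i j ij; rewrite invf_ple ?posrE ?ltr0Sn//.
      by apply: le_trans (kx (i, j) ij) _; rewrite ler_nat.
    rewrite normr_gt0 subr_eq0; apply: contra ij => /eqP/ternary_inj/xinj ->.
    by [].
  exists (pickle (n, k)); rewrite pickleK; split=> //.
  by apply/(ZE n x xinj); exists B.
Qed.

(** * Convex sets and convex hulls *)

Section convexity.
Context {R : realType} {E : lmodType R}.
Implicit Types (A : set E).

Lemma convex_setP A : @convex_set R E A <->
  forall x y (t : R), A x -> A y -> 0 <= t <= 1 -> A (t *: x + (1 - t) *: y).
Proof.
split=> [cA x y t Ax Ay /andP[t0 t1]|cA x y t /set_mem Ax /set_mem Ay].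
  exact: (set_mem (cA x y (Itv01 t0 t1) (mem_set Ax) (mem_set Ay))).
apply/mem_set; apply: (cA x y t%:num) => //.
by rewrite ge0 le1.
Qed.

Lemma convex_setI A B : @convex_set R E A -> @convex_set R E B ->
  @convex_set R E (A `&` B).
Proof.
move=> /convex_setP cA /convex_setP cB; apply/convex_setP.
by move=> x y t [Ax Bx] [Ay By] t01; split; [exact: cA|exact: cB].
Qed.

(** Induction on the number of points: the first one is split off and the other weights are divided
    by their sum. If that sum is 0, only the first point remains, with weight 1. *)
Lemma convex_set_sum A n (w : 'I_n -> R) (p : 'I_n -> E) :
  @convex_set R E A -> (forall i, 0 <= w i) -> \sum_i w i = 1 ->
  (forall i, A (p i)) -> A (\sum_i w i *: p i).
Proof.
move=> /convex_setP cA; elim: n w p => [|n IH] w p w0 w1 Ap.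
  by move/eqP: w1; rewrite big_ord0 eq_sym oner_eq0.
have rest0 : 0 <= \sum_(i < n) w (lift ord0 i) by exact: sumr_ge0.
move: w1; rewrite !big_ord_recl => w1.
have [r0|r0] := eqVneq (\sum_(i < n) w (lift ord0 i)) 0.
  rewrite big1 ?addr0 => [|i _].
    by move: w1; rewrite r0 addr0 => ->; rewrite scale1r.
  have /psumr_eq0P -> // : \sum_(i < n) w (lift ord0 i) = 0 by [].
    by rewrite scale0r.
rewrite [X in _ + X](_ : _ = (1 - w ord0) *:
    \sum_(i < n) (w (lift ord0 i) / \sum_(i < n) w (lift ord0 i)) *:
      p (lift ord0 i)); last first.
  rewrite -w1 addrC addKr scaler_sumr; apply: eq_bigr => i _.
  by rewrite scalerA mulrC divfK.
apply: cA => //; last by rewrite w0/= -w1 lerDl.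
apply: IH => // [i|]; first by rewrite divr_ge0.
by rewrite -mulr_suml divff.
Qed.

(** The convex combinations form a convex set containing each [p i], and they lie in every such
    set. *)
Lemma convex_hull_range n (p : 'I_n -> E) : convex_hull (range p) =
  [set x | exists u : 'I_n -> R,
     [/\ forall i, 0 <= u i, \sum_i u i = 1 & x = \sum_i u i *: p i]].
Proof.
apply/seteqP; split; last first.
  move=> _ [u [u0 u1 ->]] A [cA pA].
  by apply: convex_set_sum => // i; apply: pA; exists i.
apply: smallest_sub.
  apply/convex_setP => _ _ t [u [u0 u1 ->]] [v [v0 v1 ->]] /andP[t0 t1].
  exists (fun i => t * u i + (1 - t) * v i); split.
  - by move=> i; rewrite addr_ge0// mulr_ge0// subr_ge0.
  - by rewrite big_split/= -!mulr_sumr u1 v1 !mulr1 addrC subrK.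
  - rewrite !scaler_sumr -big_split/=; apply: eq_bigr => i _.
    by rewrite !scalerA scalerDl.
move=> _ [i _ <-]; exists (fun j => (j == i)%:R); split => //.
- by rewrite (bigD1 i)//= eqxx big1 ?addr0// => j /negbTE ->.
- rewrite (bigD1 i)//= eqxx scale1r big1 ?addr0// => j /negbTE ->.
  by rewrite scale0r.
Qed.

End convexity.

Lemma convex_set_image (R : realType) (E F : lmodType R) (f : {linear F -> E}) (B : set F) :
  @convex_set R F B -> @convex_set R E (f @` B).
Proof.
move=> /convex_setP cB; apply/convex_setP => _ _ t [x Bx <-] [y By <-] t01.
by exists (t *: x + (1 - t) *: y); [exact: cB|rewrite linearP linearZ].
Qed.

(** * Affine independence on the moment curve *)

Section moment_curve.
Context {R : realType}.

Definition moment m (t : R) : 'rV[R]_m := \row_(k < m) t ^+ k.+1.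

(** On the curve a polynomial of degree at most [m] is an affine functional of the point, so its
    weighted sum depends only on the total weight and the weighted sum of the points. *)
Lemma moment_horner m n (w t : 'I_n -> R) (P : {poly R}) :
  (size P <= m.+1)%N ->
  \sum_i w i * P.[t i] = P`_0 * \sum_i w i +
    \sum_(k < m) P`_k.+1 * (\sum_i w i *: moment m (t i)) 0 k.
Proof.
move=> Pm.
under eq_bigr do rewrite (horner_coef_wide _ Pm) big_ord_recl/= expr0 mulr1 mulrDr.
rewrite big_split/= mulr_sumr; congr (_ + _).
  by apply: eq_bigr => i _; rewrite mulrC.
under eq_bigr do rewrite mulr_sumr.
rewrite exchange_big/=; apply: eq_bigr => k _.
rewrite summxE mulr_sumr; apply: eq_bigr => i _.
by rewrite !mxE mulrCA.
Qed.

(* Any 2N points of the moment curve in dimension 2N-1 are affinely independent: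
   the polynomial vanishing at all the points but t i0 has degree 2N-1. *)
Lemma moment_simplex N (t s w u : 'I_N -> R) i0 :
  injective t -> w i0 != 0 -> \sum_i w i = \sum_i u i ->
  \sum_i w i *: moment (2 * N - 1) (t i) =
    \sum_i u i *: moment (2 * N - 1) (s i) ->
  exists j, s j = t i0.
Proof.
move=> tinj w0 wu wuE; apply: contrapT => nst.
pose P : {poly R} := \prod_(i | i != i0) ('X - (t i)%:P) *
  \prod_j ('X - (s j)%:P).
have N0 : (0 < N)%N by case: N i0 {t s w u tinj w0 wu wuE nst P} => // -[].
have Pm : (size P <= (2 * N - 1).+1)%N.
  have sz : size (\prod_(i | i != i0) ('X - (t i)%:P)) = N.
    rewrite -big_filter size_prod_XsubC size_filter -sum1_count sum1_card.
    by rewrite cardC1 card_ord prednK.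
  apply: leq_trans (size_polyMleq _ _) _; rewrite sz size_prod_XsubC.
  by rewrite -[index_enum _]enumT size_enum_ord; lia.
have Ps j : P.[s j] = 0.
  apply/eqP; rewrite hornerM mulf_eq0 !horner_prod; apply/orP; right.
  by apply/prodf_eq0; exists j => //; rewrite hornerXsubC subrr.
have Pt i : i != i0 -> P.[t i] = 0.
  move=> ii0; apply/eqP; rewrite hornerM mulf_eq0 !horner_prod; apply/orP; left.
  by apply/prodf_eq0; exists i => //; rewrite hornerXsubC subrr.
(* Both combinations give [P] the same weighted sum. It is 0 on the side of [s], while on the side
   of [t] only the nonzero term at [i0] survives. *)
have /esym := moment_horner u s Pm; rewrite -wu -wuE -(moment_horner w t Pm).
rewrite [RHS]big1 => [|j _]; last by rewrite Ps mulr0.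
rewrite (bigD1 i0)//= big1 ?addr0 => [|i ii0]; last by rewrite Pt ?mulr0.
apply/eqP; rewrite mulf_neq0// /P hornerM mulf_neq0// horner_prod.
  apply/prodf_neq0 => i; rewrite hornerXsubC subr_eq0.
  by apply: contra => /eqP/tinj ->.
apply/prodf_neq0 => j _; rewrite hornerXsubC subr_eq0.
by apply/eqP => e; apply: nst; exists j.
Qed.

Lemma moment_continuous m : continuous (@moment m).
Proof.
move=> t; apply/cvg_ballP => e e0.
have : \forall s \near t, forall k : 'I_m, ball (t ^+ k.+1) e (s ^+ k.+1).
  apply: (@filter_forall R 'I_m (fun k s => ball (t ^+ k.+1) e (s ^+ k.+1))
    (nbhs t) (nbhs_filter t)) => k.
  by have /cvg_ballP := @exprn_continuous R k.+1 t; exact.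
by apply: filterS => s ts; split=> // i k; rewrite !mxE; exact: ts.
Qed.

Lemma moment_norm m (t : R) : 0 <= t <= 1 -> forall k, `|moment m t 0 k| <= 1.
Proof.
by move=> /andP[t0 t1] k; rewrite mxE ger0_norm ?exprn_ge0// exprn_ile1.
Qed.

End moment_curve.

(** * Convex balls, closed unions and embeddings of compact spaces *)

Lemma ball_convex (R : realType) (V : normedModType R) (v : V) (e : R) :
  @convex_set R V (ball v e).
Proof.
apply/convex_setP => x y t; rewrite -ball_normE/= => vx vy /andP[t0 t1].
have -> : v - (t *: x + (1 - t) *: y) = t *: (v - x) + (1 - t) *: (v - y).
  rewrite !scalerBr addrACA -opprD; congr (_ - _).
  by rewrite -scalerDl addrC subrK scale1r.
rewrite (le_lt_trans (ler_normD _ _))// !normrZ !ger0_norm ?subr_ge0//.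
(* Passing through the maximum keeps the bound strict for every [t], endpoints included. *)
apply: (@le_lt_trans _ _ (Num.max `|v - x| `|v - y|)).
  have : `|v - x| <= Num.max `|v - x| `|v - y| by rewrite le_max lexx.
  have : `|v - y| <= Num.max `|v - x| `|v - y| by rewrite le_max lexx orbT.
  by set c := Num.max _ _; nra.
by rewrite gt_max vx vy.
Qed.

Lemma closed_ball0_convex (R : realType) (V : normedModType R) (e : R) :
  @convex_set R V [set v | `|v| <= e].
Proof.
apply/convex_setP => x y t /= vx vy /andP[t0 t1].
rewrite (le_trans (ler_normD _ _))// !normrZ !ger0_norm ?subr_ge0//.
set a := `|x| in vx *; set b := `|y| in vy *.
nra.
Qed.

(** The convex sets are the balls with rational centre and radius [1/(k+1)] that lie inside [U]. *)
Lemma open_bigcup_convex (R : realType) m (U : set 'rV[R]_m) : open U ->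
  exists2 K : nat -> set 'rV[R]_m,
    (forall p, @convex_set R 'rV[R]_m (K p)) & U = \bigcup_p K p.
Proof.
move=> oU.
pose W (qk : 'rV[rat]_m * nat) : set 'rV[R]_m :=
  ball (map_mx ratr qk.1 : 'rV[R]_m) (qk.2.+1%:R^-1).
exists (fun p => if unpickle p is Some qk then
    if `[< W qk `<=` U >] then W qk else set0 else set0).
  have c0 : @convex_set R 'rV[R]_m set0 by apply/convex_setP.
  move=> p; case: (unpickle p) => [qk|//].
  by case: ifP => // _; exact: ball_convex.
apply/seteqP; split => [y Uy|y [p _]]; last first.
  by case: (unpickle p) => [qk|//]; case: ifPn => // /asboolP; exact.
have /nbhs_ballP[e /= e0 eU] := oU y Uy.
(* A ball of this radius containing [y] has diameter less than [e], so it stays inside [U]. *)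
have [k ke] : exists k, k.+1%:R^-1 < e / 2.
  exists (Num.trunc (e / 2)^-1); rewrite invf_plt ?posrE ?divr_gt0//.
  exact: truncnS_gt.
have k0 : 0 < k.+1%:R^-1 :> R by rewrite invr_gt0.
have /choice[q qy] (j : 'I_m) : exists q : rat, ball (ratr q : R) k.+1%:R^-1 (y 0 j).
  have [|q] := @rat_in_itvoo R (y 0 j - k.+1%:R^-1) (y 0 j + k.+1%:R^-1).
    by rewrite ltrBlDr -addrA ltrDl addr_gt0.
  rewrite in_itv/= => qj; exists q; rewrite -ball_normE/= ltr_norml.
  by move: k.+1%:R^-1 qj => r; lra.
pose Q : 'rV[rat]_m := \row_j q j.
have yW : W (Q, k) y.
  by split => // i j; rewrite ord1 !mxE; exact: qy.
exists (pickle (Q, k)) => //; rewrite pickleK.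
case: ifPn => // /asboolP; apply: contra_notP => _ z Wz; apply: eU.
have : ball y (k.+1%:R^-1 + k.+1%:R^-1) z.
  by apply: ball_triangle Wz; exact: ball_sym.
apply: le_ball; set r := k.+1%:R^-1 in ke *; lra.
Qed.

(** If [X] misses the ball of radius [e] around [y], then the sets [M p] within [e/2] of [X] miss
    the ball of radius [e/2]. Only finitely many closed sets [M p] remain to be avoided. *)
Lemma closed_setU_accumulating (R : realType) (V : pseudoMetricType R)
    (X : set V) (M : nat -> set V) :
  closed X -> (forall p, closed (M p)) ->
  (forall e : R, 0 < e -> exists P, forall p v, (P <= p)%N -> M p v ->
     exists2 x, X x & ball x e v) ->
  closed (X `|` \bigcup_p M p).
Proof.
move=> cX cM acc y cly; apply: contrapT => /not_orP[nXy nMy].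
have /nbhs_ballP[e /= e0 eX] : nbhs y (~` X).
  by apply: open_nbhs_nbhs; split=> //; exact: closed_openC.
have e2 : 0 < e / 2 by rewrite divr_gt0.
have [P accP] := acc _ e2.
have nM : nbhs y (~` \bigcup_(p in `I_P) M p).
  apply: open_nbhs_nbhs; split; last by move=> [p _ Mp]; apply: nMy; exists p.
  by apply: closed_openC; apply: closed_bigcup.
have [z [Xz [yz nMz]]] := cly _ (filterI (nbhsx_ballx y _ e2) nM).
case: Xz => [Xz|[p _ Mpz]].
  by apply: (eX z) => //; apply: le_ball yz; rewrite ler_pdivrMr// ler_pMr// ler1n.
have [pP|Pp] := ltnP p P; first by apply: nMz; exists p.
have [x Xx xz] := accP _ _ Pp Mpz.
apply: (eX x) => //; rewrite [e]splitr; apply: ball_triangle yz _.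
exact: ball_sym.
Qed.

(** Closed subsets of a compact space have compact, hence closed, images in a Hausdorff space; so
    the inverse is continuous. *)
Lemma continuous_inj_homeomorphism (T U : topologicalType) (g : T -> U) :
  compact [set: T] -> hausdorff_space U -> continuous g -> injective g ->
  exists2 f : T -> range g, homeomorphism f & forall x, set_val (f x) = g x.
Proof.
move=> cT hU cg ginj.
have gx x : g x \in range g by apply/mem_set; exists x.
have /choice[h hK] (y : range g) : exists x, g x = set_val y.
  by have [x _ xy] := set_mem (valP y); exists x.
exists (fun x => exist _ (g x) (gx x)) => //; split.
  exact: continuous_comp_initial.
exists h; last first.
  split=> [x|y]; first by apply: ginj; rewrite hK.
  by apply: val_inj => /=; rewrite hK.
apply/continuous_closedP => A cA.
rewrite (_ : h @^-1` A = set_val @^-1` (g @` A)).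
  apply: preimage_closed; first by move=> y _; exact: initial_continuous.
  apply: compact_closed => //; apply: continuous_compact.
    exact: continuous_subspaceT.
  exact: subclosed_compact cA cT _.
apply/seteqP; split => [y /= Ay|y /= [x Ax xy]]; first by exists (h y).
by rewrite (_ : h y = x)//; apply: ginj; rewrite hK.
Qed.

(** * The linear injection of coordinate space into [E] *)

Section linear_combination.
Context {R : realType} {E : topologicalLmodType R} {m : nat}.
Variable v : 'I_m -> E.

Definition lincomb (a : 'rV[R]_m) : E := \sum_k a 0 k *: v k.

Lemma lincomb_is_linear : linear lincomb.
Proof.
move=> t a b; rewrite /lincomb scaler_sumr -big_split/=; apply: eq_bigr => k _.
by rewrite !mxE scalerDl scalerA.
Qed.

HB.instance Definition _ :=
  GRing.isLinear.Build R 'rV[R]_m E _ lincomb lincomb_is_linear.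

Lemma lincomb_inj : linearly_independent v -> injective lincomb.
Proof.
move=> vfree a b /eqP; rewrite -subr_eq0 -linearB => /eqP ab0.
apply/rowP => k; have := vfree (fun k => (a - b) 0 k) ab0 k.
by move/eqP; rewrite !mxE subr_eq0 => /eqP.
Qed.

Lemma lincomb_continuous : continuous lincomb.
Proof.
apply: continuous_big => [|k _]; first exact: add_continuous.
have cvk : continuous (fun a : 'rV[R]_m => (a 0 k : R^o, v k)).
  move=> a; exact: (cvg_pair (@coord_continuous R 1 m 0 k a) (@cvg_cst E (v k) _ (nbhs a) _)).
by move=> a; exact: (continuous_comp (cvk a) (@scale_continuous R E _)).
Qed.

End linear_combination.

(** * The removed points and their accumulation on the curve *)

Section weighted_points.
Context {R : realType}.
Variable n : nat.
Local Notation N := n.+2.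
Local Notation m := (2 * N - 1)%N.
Local Notation tuples := (prod_topology (fun _ : 'I_N => cantor_space)).

Definition cantor_moment (x : cantor_space) : 'rV[R]_m := moment m (ternary x).

Definition weight p (i : 'I_N) : R :=
  (if i == ord0 then p.+1%:R else 1) / (N + p)%:R.

(* As p grows these points of the open simplex spanned by x tend to its first
   vertex, so that the removed sets accumulate only at the curve. *)
Definition weighted_point p (x : tuples) : 'rV[R]_m :=
  \sum_i weight p i *: cantor_moment (x i).

Lemma cantor_moment_continuous : continuous cantor_moment.
Proof.
move=> x; apply: (@continuous_comp _ _ _ ternary (@moment R m)).
  exact: ternary_continuous.
exact: moment_continuous.
Qed.

Lemma cantor_moment_norm x : `|cantor_moment x| <= 1.
Proof.
rewrite [leLHS](_ : _ = mx_norm (cantor_moment x))// mx_normrE; apply: bigmax_le => // -[i k] _ /=.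
by rewrite ord1; apply: moment_norm; exact: ternary_itv.
Qed.

(** With all weights of [x] nonzero, this recovers every vertex of [x] from the point: a removed
    point determines the N-set it was chosen for. *)
Lemma cantor_moment_simplex (x y : 'I_N -> cantor_space) (w u : 'I_N -> R) i0 :
  injective x -> w i0 != 0 -> \sum_i w i = \sum_i u i ->
  \sum_i w i *: cantor_moment (x i) = \sum_i u i *: cantor_moment (y i) ->
  exists j, y j = x i0.
Proof.
move=> xinj w0 wu wuE.
have [||||j /ternary_inj yx] := @moment_simplex R N (fun i => ternary (x i))
  (fun i => ternary (y i)) w u i0 => //.
  by move=> i j /ternary_inj/xinj.
by exists j.
Qed.

Lemma cantor_moment_inj : injective cantor_moment.
Proof.
move=> x y /rowP; have m0 : (0 < m)%N by rewrite subn_gt0 mulnS.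
by move=> /(_ (Ordinal m0)); rewrite !mxE !expr1 => /ternary_inj.
Qed.

Lemma weight_gt0 p i : 0 < weight p i.
Proof. by rewrite /weight divr_gt0// ?ltr0n//; case: ifP. Qed.

Lemma weight_sum p : \sum_i weight p i = 1.
Proof.
rewrite -mulr_suml big_ord_recl eqxx/= sumr_const card_ord.
by rewrite -natrD addSnnS addnC divff// pnatr_eq0.
Qed.

Lemma weighted_point_continuous p : continuous (weighted_point p).
Proof.
apply: continuous_big => [|i _ x]; first exact: add_continuous.
apply: cvgZr; apply: (@tuple_coord_continuous N _ _ _ i).
exact: cantor_moment_continuous.
Qed.

(** The difference is a weighted sum of chords from the first vertex. The chord with the large
    weight is 0; each of the other [n+1] has length at most 2 and weight [1/(N+p)]. *)
Lemma weighted_point_near p x :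
  `|cantor_moment (x ord0) - weighted_point p x| <= (2 * N)%:R / (N + p)%:R.
Proof.
have -> : cantor_moment (x ord0) - weighted_point p x =
    \sum_i weight p i *: (cantor_moment (x ord0) - cantor_moment (x i)).
  under [RHS]eq_bigr do rewrite scalerBr.
  by rewrite sumrB -scaler_suml weight_sum scale1r.
rewrite big_ord_recl subrr scaler0 add0r (le_trans (ler_norm_sum _ _ _))//.
apply: (@le_trans _ _ (\sum_(i < n.+1) (2 / (N + p)%:R))).
  apply: ler_sum => i _; rewrite normrZ gtr0_norm ?weight_gt0//.
  rewrite /weight/= mul1r mulrC ler_wpM2r ?invr_ge0//.
  rewrite (le_trans (ler_normB _ _))//.
  by rewrite (natrD _ 1 1) lerD// cantor_moment_norm.
rewrite sumr_const card_ord -[leLHS]mulr_natl mulrA ler_wpM2r ?invr_ge0//.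
by rewrite -natrM ler_nat mulnC leq_mul2l leqnSn orbT.
Qed.

Lemma closed_moment_weighted (D : nat -> set tuples) :
  (forall p, closed (D p)) ->
  closed (range cantor_moment `|` \bigcup_p (weighted_point p @` D p)).
Proof.
move=> cD; have hV : hausdorff_space 'rV[R]_m by exact: norm_hausdorff.
apply: closed_setU_accumulating.
- apply: compact_closed => //; apply: continuous_compact.
    by apply: continuous_subspaceT; exact: cantor_moment_continuous.
  exact: cantor_space_compact.
- move=> p; apply: compact_closed => //; apply: continuous_compact.
    by apply: continuous_subspaceT; exact: weighted_point_continuous.
  exact: compact_tuples.
(* For these [p] one has [2N/e < N+p], so the distance to the curve is below [e]. *)
move=> e e0; exists (Num.trunc ((2 * N)%:R / e)).+1 => p _ Pp [x _ <-].
exists (cantor_moment (x ord0)); first by exists (x ord0).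
rewrite -ball_normE/= (le_lt_trans (weighted_point_near _ _))//.
rewrite ltr_pdivrMr// mulrC -ltr_pdivrMr//.
by rewrite (lt_le_trans (truncnS_gt _))// ler_nat (leq_trans Pp)// leq_addl.
Qed.

End weighted_points.

Lemma linear_sum_scale (R : realType) (E F : lmodType R) (f : {linear F -> E})
    n (w : 'I_n -> R) (p : 'I_n -> F) :
  f (\sum_i w i *: p i) = \sum_i w i *: f (p i).
Proof. by rewrite linear_sum; apply: eq_bigr => i _; rewrite linearZ. Qed.

(** * Construction of [S] in [E] and verification of its properties *)

Theorem theorem6p2 (R : realType) (N : nat) (hN : (1 < N)%N)
    (E : topologicalLmodType R) (hE : polish_space R E)
    (hdim : dim_at_least E (2 * N - 1))
    (C : set (Nsubset_space cantor_space N)) (hC : Fsigma C) :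
  exists (S X : set E) (f : cantor_space -> X),
    [/\ Gdelta S,
        X `<=` S,
        homeomorphism f,
        (exists2 K : nat -> set E,
           (forall i, @convex_set R E (K i)) & S `\` X = \bigcup_i K i) &
        forall T : set E, T `<=` X -> Nsubsets N T ->
          (~ (convex_hull T `<=` S) <->
           (set_of_Nsubset @` C) ((set_val \o f) @^-1` T))].
Proof.
case: hE => _ [d [dm dt _]]; have hausE := metric_hausdorff dm dt.
case: hdim => v /lincomb_inj; set phi := lincomb v => phi_inj.
have phi_cont : continuous phi by exact: lincomb_continuous.
(* In the form [n.+2] the indices [ord0] and [ord_max] are distinct. *)
case: N hN C hC v @phi phi_inj phi_cont => [//|[//|n]] _ C hC v phi phi_inj phi_cont.
have [D [cD DC CD]] := Fsigma_coloring_tuples R hC.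
pose g x : E := phi (cantor_moment n x).
have g_inj : injective g by move=> x y /phi_inj/cantor_moment_inj.
have g_cont : continuous g.
  move=> x; apply: (@continuous_comp _ _ _ (@cantor_moment R n) phi).
    exact: cantor_moment_continuous.
  exact: phi_cont.
have [f homf fE] :=
  continuous_inj_homeomorphism cantor_space_compact hausE g_cont g_inj.
pose B := [set a : 'rV[R]_(2 * n.+2 - 1) | `|a| <= 1].
have B_convex : @convex_set R _ B by exact: closed_ball0_convex.
pose b p := @weighted_point R n p.
pose M := \bigcup_p (b p @` D p).
(* If the point removed for [x] is an affine combination of the curve points at [y], then every
   entry of [x] is an entry of [y]. *)
have bE p x (y : 'I_n.+2 -> cantor_space) (u : 'I_n.+2 -> R) :
    D p x -> \sum_i u i = 1 -> b p x = \sum_i u i *: cantor_moment n (y i) ->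
    forall i, exists j, y j = x i.
  move=> /DC[xinj _] u1 bu i.
  apply: (@cantor_moment_simplex R n x y (weight p) u) => //.
    by rewrite gt_eqF// weight_gt0.
  by rewrite weight_sum u1.
have compactB : compact B.
  apply: bounded_closed_compact.
    by exists 1; split => // r r1 a /= /le_trans; apply; exact: ltW.
  apply: (@preimage_closed _ _ (fun a : 'rV[R]_(2 * n.+2 - 1) => `|a|)
    [set r | r <= 1]); last exact: closed_le.
  by move=> a _; exact: norm_continuous.
have phi_closed A : compact A -> closed (phi @` A).
  move=> cA; apply: compact_closed => //; apply: continuous_compact => //.
  exact: continuous_subspaceT.
pose S := phi @` B `\` phi @` M.
(* A curve point is the combination with a single weight 1, so if it were removed for [y], all
   entries of [y] would equal [x]; but [y] is one-to-one with at least two entries. *)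
have gNM x : ~ M (cantor_moment n x).
  move=> [p _ [y Dy ybx]].
  have := @bE p y (fun=> x) (fun i => (i == ord0)%:R) Dy.
  rewrite big_ord_recl big1// addr0 => /(_ erefl).
  rewrite big_ord_recl big1 ?addr0 => [|i _]; last by rewrite scale0r.
  rewrite scale1r => /(_ ybx) xy.
  have [_ xy0] := xy ord0; have [_ xy1] := xy ord_max.
  by have [/(_ ord0 ord_max)] := DC _ _ Dy; rewrite -xy0 -xy1 => /(_ erefl).
exists S, (range g), f; split => //.
- apply: Gdelta_setD; first exact/(metric_closed_Gdelta dm dt)/phi_closed.
  exists (fun p => phi @` (b p @` D p)).
    move=> p; apply/phi_closed/continuous_compact; last exact: compact_tuples.
    by apply: continuous_subspaceT; exact: weighted_point_continuous.
  by rewrite /M image_bigcup.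
- move=> _ [x _ <-]; split; first by exists (cantor_moment n x) => //=;
    exact: cantor_moment_norm.
  by move=> [a Ma /phi_inj ax]; apply: (gNM x); rewrite -ax.
(* The complement of the curve and of [M] is open, hence a union of convex sets [K p]. Cutting these
   with the convex ball [B] and applying [phi] gives the pieces of [S] minus the curve. *)
- have /closed_openC/open_bigcup_convex[K cK KE] :=
    @closed_moment_weighted R n D cD.
  exists (fun p => phi @` (B `&` K p)).
    by move=> p; apply: convex_set_image; exact: convex_setI.
  rewrite -image_bigcup -setI_bigcupr -KE setCU -/M.
  apply/seteqP; split => [_ [[[a Ba <-] nMa] nXa]|_ [a [Ba [nXa nMa]] <-]].
    exists a => //; split => //; split; last by move=> Ma; apply: nMa; exists a.
    by move=> [x _ xa]; apply: nXa; exists x => //; rewrite /g xa.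
  split; last by move=> [x _ /phi_inj xa]; apply: nXa; exists x.
  by split; [exists a|move=> [c Mc /phi_inj ca]; apply: nMa; rewrite -ca].
move=> T TX /NsubsetsP[q [q_inj qT]].
have /choice[y yq] i : exists x, g x = q i.
  by have [|x _ xq] := TX (q i); [rewrite -qT; exists i|exists x].
have y_inj : injective y.
  by move=> i j yij; apply: q_inj; rewrite -!yq yij.
have -> : (set_val \o f) @^-1` T = range y.
  rewrite -qT; apply/seteqP; split => [x [i _]|_ [i _ <-]].
    by rewrite /= fE -yq => /g_inj yx; exists i.
  by exists i => //=; rewrite fE yq.
have hullE : convex_hull T = phi @` [set a | exists u : 'I_n.+2 -> R,
    [/\ forall i, 0 <= u i, \sum_i u i = 1 &
        a = \sum_i u i *: cantor_moment n (y i)]].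
  have uE (u : 'I_n.+2 -> R) : \sum_i u i *: q i =
      phi (\sum_i u i *: cantor_moment n (y i)).
    apply: etrans (esym (linear_sum_scale (lincomb v) u _)).
    by apply: eq_bigr => i _; rewrite -yq.
  rewrite -qT convex_hull_range; apply/seteqP; split.
    move=> _ [u [u0 u1 ->]]; exists (\sum_i u i *: cantor_moment n (y i)) => //.
    by exists u.
  by move=> _ [_ [u [u0 u1 ->]] <-]; exists u; split.
split.
  move=> /existsNP[z /not_implyP[]]; rewrite hullE => -[a [u [u0 u1 ua]] <-] nSa.
  have Ba : B a.
    by rewrite ua; apply: convex_set_sum => // i; exact: cantor_moment_norm.
  have [p _ [x Dx xa]] : M a.
    apply: contrapT => nMa; apply: nSa; split; first by exists a.
    by move=> [c Mc /phi_inj ca]; apply: nMa; rewrite -ca.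
  (* The map [s] locates the entries of [x] among those of [y]. It is injective on a finite index
     set, hence onto, so both tuples have the same range, and that range is in [C]. *)
  have /choice[s sE] := bE p x y u Dx u1 (etrans xa ua).
  have [x_inj] := DC _ _ Dx; congr (_ _).
  have s_inj : injective s by move=> i j sij; apply: x_inj; rewrite -!sE sij.
  apply/seteqP; split => [_ [i _ <-]|_ [j _ <-]]; first by exists (s i).
  have /codomP[i ->] : j \in codom s by exact: injF_onto.
  by exists i.
(* Conversely the sets [D p] cover every enumeration of a colored set, in particular [y]; the point
   removed for [y] lies in the hull. *)
move=> /(CD _ y_inj)[p Dpy]; apply/existsNP.
exists (phi (b p y)); apply/not_implyP; split; last first.
  by move=> [_]; apply; exists (b p y) => //; exists p => //; exists y.
rewrite hullE; exists (b p y) => //; exists (weight p); split => //.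
- by move=> i; rewrite ltW// weight_gt0.
- exact: weight_sum.
Qed.
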